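(* Let $x\in\mathbb{E}$, $H>0$, $\tau_H=\left[\dfrac{(3+\nu)H}{6H_{f,3}(\nu)}\right]^{\frac{1}{1+\nu}}$ and $$\rho_x(y)\equiv\frac12\langle\nabla^2f(x)(y-x),y-x\rangle+\frac{1}{3+\nu}\|y-x\|^{3+\nu}.$$ Then the following assertions hold: (a) The function $\Omega_{x,3,H}^{(\nu)}$ is $L_H$-smooth relative to $\rho_x$ for $$L_H=\max\left\{\frac{\tau_H+1}{\tau_H},\ \tau_H^{\nu}(\tau_H+1)H_{f,3}(\nu)\right\}.$$ (b) If $\tau_H\ge1$, then $\Omega_{x,3,H}^{(\nu)}$ is $\mu_H$-strongly convex relative to $\rho_x$ for $$\mu_H=\min\left\{\frac{\tau_H-1}{\tau_H},\ \tau_H^{\nu}(\tau_H-1)H_{f,3}(\nu)\right\}.$$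
   Context: $\mathbb{E}$ is a finite-dimensional real vector space with dual $\mathbb{E}^*$ and pairing $\langle s,x\rangle$; $B:\mathbb{E}\to\mathbb{E}^*$ is a fixed self-adjoint positive definite operator and $\|x\|=\langle Bx,x\rangle^{1/2}$. For a symmetric trilinear form, $\|D^3f(x)\|=\max\{|D^3f(x)[h]^3|:\|h\|\le1\}$, and likewise for differences; $[h]^3$ means all three arguments equal $h$. $f:\mathbb{E}\to\mathbb{R}$ is convex and three times differentiable, $\nu\in[0,1]$, and $H_{f,3}(\nu)>0$ is a constant with $\|D^3f(u)-D^3f(v)\|\le H_{f,3}(\nu)\|u-v\|^{\nu}$ for all $u,v\in\mathbb{E}$. For $x\in\mathbb{E}$ and $H>0$, $$\Omega_{x,3,H}^{(\nu)}(y)=f(x)+\langle\nabla f(x),y-x\rangle+\tfrac12\langle\nabla^2f(x)(y-x),y-x\rangle+\tfrac16D^3f(x)[y-x]^3+\tfrac{H}{6}\|y-x\|^{3+\nu}.$$ For a differentiable convex function $d$ let $\beta_d(u,v)=d(v)-d(u)-\langle\nabla d(u),v-u\rangle$. A differentiable $g:\mathbb{E}\to\mathbb{R}$ is $L$-smooth relative to $d$ if $g(v)\le g(u)+\langle\nabla g(u),v-u\rangle+L\beta_d(u,v)$ for all $u,v\in\mathbb{E}$, and $\mu$-strongly convex relative to $d$ (with $\mu\ge0$) if $g(v)\ge g(u)+\langle\nabla g(u),v-u\rangle+\mu\beta_d(u,v)$ for all $u,v\in\mathbb{E}$. *)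

(* Defs.v *)
From HB Require Import structures.
From mathcomp Require Import all_boot all_order all_algebra.
From mathcomp Require Import all_classical all_reals all_analysis.

Set Implicit Arguments.
Unset Strict Implicit.
Unset Printing Implicit Defensive.

Import Order.TTheory GRing.Theory Num.Theory.
Import numFieldNormedType.Exports.

Local Open Scope ring_scope.
Local Open Scope classical_set_scope.

#[short(type="finNormedModType")]
HB.structure Definition FinNormedModule (K : numFieldType) :=
  {E of NormedModule K E & Vector K E}.

Section Defs.
Context {R : realType} {E : finNormedModType R}.
Implicit Types (f g d : E -> R) (x y u v h : E).

(* The dual of E is 'Hom(E, R^o), with pairing <s, x> = s x. *)
Implicit Types B : 'Hom(E, 'Hom(E, R^o)).

Definition self_adjoint B := forall x y, B x y = B y x.

Definition positive_definite B := forall x, x != 0 -> 0 < (B x x : R).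

(* The norm carried by E is the Euclidean one. Nothing is lost by this, since
   all norms on a finite-dimensional E give the same derivatives. *)
Definition normed_by B := forall x, `|x| = Num.sqrt (B x x : R).

(* D2 f x h1 h2 = D^2f(x)[h1, h2] = <D^2f(x) h1, h2>, and likewise for D3. *)
Definition D2 f x h1 h2 : R := 'd (fun y => 'd f y h1) x h2.
Definition D3 f x h1 h2 h3 : R := 'd (fun y => D2 f y h1 h2) x h3.

(* As E is finite-dimensional, the maps y |-> Df(y) and y |-> D^2f(y) into the
   spaces of linear and bilinear forms are Frechet differentiable iff their
   evaluations at all fixed vectors are. *)
Definition thrice_differentiable f :=
  [/\ forall x, differentiable f x,
      forall h x, differentiable (fun y => 'd f y h) x
    & forall h1 h2 x, differentiable (fun y => D2 f y h1 h2) x].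

(* For a trilinear T the set below is nonempty and bounded, so that sup is not
   a default value; as the unit ball is compact, it is a maximum. *)
Definition trinorm (T : E -> E -> E -> R) : R :=
  sup [set `|T h h h| | h in [set h : E | `|h| <= 1]].

Definition D3_hoelder f (nu Hf : R) := forall u v,
  trinorm (fun h1 h2 h3 => D3 f u h1 h2 h3 - D3 f v h1 h2 h3)
    <= Hf * `|u - v| `^ nu.

Definition Omega f x (H nu : R) : E -> R := fun y =>
  f x + 'd f x (y - x) + 1 / 2 * D2 f x (y - x) (y - x)
  + 1 / 6 * D3 f x (y - x) (y - x) (y - x) + H / 6 * `|y - x| `^ (3 + nu).

Definition rho f x (nu : R) : E -> R := fun y =>
  1 / 2 * D2 f x (y - x) (y - x) + 1 / (3 + nu) * `|y - x| `^ (3 + nu).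

Definition convex f := convex_function [set: E] f.

Definition bregman d u v : R := d v - d u - 'd d u (v - u).

(* Differentiability and convexity are part of the two notions below: 'd g u
   is meaningful only where g is differentiable. *)
Definition relatively_smooth g d (L : R) :=
  [/\ forall x, differentiable g x,
      forall x, differentiable d x,
      convex d
    & forall u v, g v <= g u + 'd g u (v - u) + L * bregman d u v].

Definition relatively_strongly_convex g d (mu : R) :=
  [/\ forall x, differentiable g x,
      forall x, differentiable d x,
      convex d,
      0 <= mu
    & forall u v, g v >= g u + 'd g u (v - u) + mu * bregman d u v].

End Defs.

Definition tauH {R : realType} (H nu Hf : R) : R :=
  ((3 + nu) * H / (6 * Hf)) `^ (1 / (1 + nu)).

(* Main.v *)
Require Import Defs.
From HB Require Import structures.
From mathcomp Require Import all_boot all_order all_algebra.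
From mathcomp Require Import all_classical all_reals all_analysis.
From mathcomp Require Import ring lra.

Set Implicit Arguments.
Unset Strict Implicit.
Unset Printing Implicit Defensive.

Import Order.TTheory GRing.Theory Num.Theory.
Import numFieldNormedType.Exports.

Local Open Scope ring_scope.

(** The function [Omega f x H nu] is twice differentiable, with Hessian at [y]
    equal to [D2 f x + D3 f x (y - x)] plus [H / 6] times the Hessian of
    [|y - x| ^ (3 + nu)]. The theorem compares this with the Hessian of [rho].

    The cubic term is controlled by convexity. Taylor's formula for [D2 f] at
    [x + t h] and at [x - t h], where the second derivative is nonnegative,
    gives
      [|D3 f x h u u| <= D2 f x u u / t + t ^ nu * Hf * |h| ^ (1 + nu) * |u| ^ 2]
    for every [t > 0] ([D3_convex_bound]). Its remainder involves the mixed
    values [T h u u] of a difference [T] of third derivatives, whereas the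
    Hoelder condition bounds only the values [T h h h]; the passage from the
    latter to the former is Banach's theorem on symmetric forms
    ([trilinear_diag_bound]), which in degree 3 has an elementary proof by
    trigonometric interpolation in the plane of [h] and [u]. The symmetry of
    second and third derivatives is Schwarz's theorem ([diff_diff_sym]).

    Hessians of [|.| ^ (3 + nu)] are avoided: relative smoothness and relative
    strong convexity follow from inequalities between the increments of the two
    gradients from [u] to [v], paired with [v - u]. There the cubic term
    contributes exactly [D3 f x m (v - u) (v - u)], with [m] the midpoint of
    [u - x] and [v - x], and the power of the norm contributes [norm_gap],
    which is at least [|m| ^ (1 + nu) * |v - u| ^ 2]
    ([norm_powR_gradient_monotone]). Since [t = tauH H nu Hf] satisfies
    [(3 + nu) * H / 6 = t ^ (1 + nu) * Hf], the increment for [Omega] is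
    squeezed between
      [(1 - 1 / t) * Q + t ^ nu * (t - 1) * Hf * N] and
      [(1 + 1 / t) * Q + t ^ nu * (t + 1) * Hf * N],
    where [Q = D2 f x (v - u) (v - u)] and [N] is [norm_gap], and the increment
    for [rho] is [Q + N]. *)

(** * Differential calculus on normed spaces *)

Section NormedSpaceCalculus.
Context {R : realType} {V : normedModType R}.
Implicit Types (f g : V -> R) (x h k v : V).

Lemma differentiable_expansion f x : differentiable f x ->
  forall e : R, 0 < e -> exists2 d : R, 0 < d &
    forall h, `|h| < d -> `|f (x + h) - f x - 'd f x h| <= e * `|h|.
Proof.
move=> /diff_locally/eqaddoP fx e /fx /nbhs_ballP[d /= d0 dP].
exists d => // h hd; have := dP h; rewrite -ball_normE /= sub0r normrN => /(_ hd).
by rewrite -addrA -opprD [x + h]addrC.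
Qed.

Lemma is_diff_expansion f x (l : {linear V -> R}) (K : R) :
  (forall h, `|l h| <= K * `|h|) ->
  (forall e : R, 0 < e -> exists2 d : R, 0 < d &
    forall h, `|h| < d -> `|f (x + h) - f x - l h| <= e * `|h|) ->
  is_diff x f l.
Proof.
move=> lK fe.
have lc : continuous l.
  apply: bounded_linear_continuous; apply/linear_boundedP.
  exists K; split=> [|r Kr h]; first exact: num_real.
  by apply: le_trans (lK h) _; rewrite ler_wpM2r// ltW.
have fl : f \o shift x = cst (f x) + l +o_ 0 id.
  apply/eqaddoP => e /fe[d d0 dP]; apply/nbhs_ballP; exists d => //= h.
  rewrite -ball_normE /= sub0r normrN => /dP.
  by rewrite [x + h]addrC -addrA -opprD.
have dl := diff_unique lc fl.
by split => //; apply/diff_locallyP; rewrite dl.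
Qed.

Lemma is_derive_line f x v (t : R) : differentiable f (x + t *: v) ->
  is_derive t 1 (fun s : R => f (x + s *: v)) ('d f (x + t *: v) v).
Proof.
move=> df.
have dL : is_diff t (fun s => x + s *: v) ( *:%R ^~ v).
  by apply: is_diff_eq; rewrite add0r.
have dc := @is_diff_comp _ _ _ _ _ _ _ _ _ dL (differentiableP df).
have dc' : differentiable (fun s : R => f (x + s *: v)) t by case: dc.
apply: DeriveDef; first exact/derivable1_diffP.
by rewrite deriveE//; case: dc => _ -> /=; rewrite scale1r.
Qed.

Lemma mean_value_line f x v : (forall y, differentiable f y) ->
  exists2 s : R, 0 < s < 1 & f (x + v) - f x = 'd f (x + s *: v) v.
Proof.
move=> df.
have dd (s : R) : is_derive s 1 (fun s : R => f (x + s *: v)) ('d f (x + s *: v) v).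
  exact: is_derive_line.
have [|s] := @MVT R _ _ 0 1 ltr01 (fun s _ => dd s).
  by apply: derivable_within_continuous => s _; case: (dd s).
rewrite in_itv /= => s01; rewrite scale0r addr0 scale1r subr0 mulr1 => ->.
by exists s.
Qed.

(** The same point [s] serves both segments, so that a second difference is an
    increment of the first derivative. *)
Lemma mean_value_line2 f x y v : (forall z, differentiable f z) ->
  exists2 s : R, 0 < s < 1 & (f (x + v) - f x) - (f (y + v) - f y) =
    'd f (x + s *: v) v - 'd f (y + s *: v) v.
Proof.
move=> df.
have dd (s : R) : is_derive s 1
    ((fun s : R => f (x + s *: v)) - (fun s : R => f (y + s *: v)))
    ('d f (x + s *: v) v - 'd f (y + s *: v) v).
  by apply: is_deriveB; exact: is_derive_line.
have [|s] := @MVT R _ _ 0 1 ltr01 (fun s _ => dd s).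
  by apply: derivable_within_continuous => s _; case: (dd s).
rewrite in_itv /= => s01 E; exists s => //; rewrite -[RHS]mulr1 -[in RHS](subr0 1) -E.
by rewrite !fctE !scale0r !addr0 !scale1r; ring.
Qed.

(** Only the map [y |-> 'd f y h] needs to be differentiable at [x]; exchanging
    [h] and [k] leaves the second difference unchanged. *)
Lemma second_difference_expansion f x h k : (forall y, differentiable f y) ->
  differentiable (fun y => 'd f y h) x ->
  forall e : R, 0 < e -> exists2 d : R, 0 < d & forall t : R, 0 < t < d ->
    `|f (x + t *: k + t *: h) - f (x + t *: k) - (f (x + t *: h) - f x)
      - t ^+ 2 * 'd (fun y => 'd f y h) x k| <= e * t ^+ 2.
Proof.
move=> df dh e e0; set G : V -> R := fun y => 'd f y h; set D := 'd G x.
(* [t * M] bounds the sum of the lengths of the two displacements [w1], [w2]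
   from [x] at which [G] is expanded. *)
pose M := 2 * `|h| + `|k| + 1.
have h0 := normr_ge0 h; have k0 := normr_ge0 k.
have M0 : 0 < M by rewrite /M; lra.
have [d d0 dP] := differentiable_expansion dh (divr_gt0 e0 M0).
exists (d / M) => [|t /andP[t0 td]]; first exact: divr_gt0.
rewrite ltr_pdivlMr// in td.
have [s /andP[s0 s1] ->] := mean_value_line2 (x + t *: k) x (t *: h) df.
have dtZ y : 'd f y (t *: h) = t * G y by rewrite linearZ.
rewrite !dtZ.
pose w2 := s *: (t *: h); pose w1 := t *: k + w2.
have n2 : `|w2| <= t * `|h|.
  rewrite /w2 !normrZ (gtr0_norm s0) (gtr0_norm t0) ler_piMl ?(ltW s1)//.
  by rewrite mulr_ge0 ?(ltW t0).
have n1 : `|w1| <= t * `|k| + t * `|h|.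
  by rewrite (le_trans (ler_normD _ _))// lerD// normrZ gtr0_norm.
have := dP w1; have := dP w2; rewrite -/G -/D.
have {}n1 : `|w1| <= t * (`|k| + `|h|) by rewrite mulrDr.
have Mt : t * M = t * `|h| + t * (`|k| + `|h|) + t by rewrite /M; ring.
have th0 : 0 <= t * `|h| by rewrite mulr_ge0// ltW.
have tk0 : 0 <= t * (`|k| + `|h|) by rewrite mulr_ge0 ?addr_ge0// ltW.
have -> : x + t *: k + s *: (t *: h) = x + w1 by rewrite -addrA.
rewrite -/w2 => /(_ ltac:(lra)) b2 /(_ ltac:(lra)) b1.
have -> : t * G (x + w1) - t * G (x + w2) - t ^+ 2 * D k =
  t * ((G (x + w1) - G x - D w1) - (G (x + w2) - G x - D w2)).
  rewrite [D w1](_ : _ = t * D k + D w2); last by rewrite /w1 linearD linearZ.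
  ring.
rewrite normrM gtr0_norm// expr2 mulrCA ler_pM2l// (le_trans (ler_normB _ _))//.
apply: le_trans (lerD b1 b2) _; rewrite -mulrDr -mulrA ler_pM2l//.
rewrite mulrC ler_pdivrMr//; lra.
Qed.

(** Schwarz's theorem, under twofold Frechet differentiability. *)
Lemma diff_diff_sym f x h k : (forall y, differentiable f y) ->
  (forall h, differentiable (fun y => 'd f y h) x) ->
  'd (fun y => 'd f y h) x k = 'd (fun y => 'd f y k) x h.
Proof.
move=> df ddf; set A := LHS; set B := RHS.
apply/eqP; rewrite -subr_eq0 -normr_le0; apply/ler_addgt0Pl => e e0.
rewrite addr0.
have e2 : 0 < e / 2 by rewrite divr_gt0.
have [d d0 dP] := second_difference_expansion k df (ddf h) e2.
have [d' d'0 d'P] := second_difference_expansion h df (ddf k) e2.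
pose t := Num.min d d' / 2.
have m0 : 0 < Num.min d d' by rewrite lt_min d0.
have t0 : 0 < t by rewrite divr_gt0.
have : t < Num.min d d' by rewrite /t; lra.
rewrite lt_min => /andP[td td'].
have := dP t; have := d'P t; rewrite t0 td td' -/A -/B => /(_ isT) b1 /(_ isT) b2.
rewrite -(@ler_pM2l _ (t ^+ 2)) ?exprn_gt0//.
rewrite -[X in X * `|_|]gtr0_norm ?exprn_gt0// -normrM.
move: b1 b2; rewrite [x + t *: h + t *: k]addrAC.
set P := f (_ + t *: h); move: P => P.
by rewrite !ler_norml => /andP[? ?] /andP[? ?]; apply/andP; split; lra.
Qed.

End NormedSpaceCalculus.

(** * Euclidean spaces and symmetric trilinear forms *)

Section EuclideanSpace.
Context {R : realType} {E : finNormedModType R}.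
Context {B : 'Hom(E, 'Hom(E, R^o))}.
Hypotheses (B_sym : self_adjoint B) (B_pos : positive_definite B)
  (E_norm : normed_by B).
Implicit Types (x y u v w h : E) (a b c : R).

Local Notation ip x y := (B x y : R).

Lemma ipDl x y v : ip (x + y) v = ip x v + ip y v.
Proof. by rewrite linearD add_lfunE. Qed.

Lemma ipDr v x y : ip v (x + y) = ip v x + ip v y.
Proof. exact: linearD. Qed.

Lemma ipZl a x y : ip (a *: x) y = a * ip x y.
Proof. by rewrite linearZ scale_lfunE. Qed.

Lemma ipZr a x y : ip x (a *: y) = a * ip x y.
Proof. exact: linearZ. Qed.

Lemma ip_ge0 x : 0 <= ip x x.
Proof.
by have [->|/B_pos/ltW//] := eqVneq x 0; rewrite linear0.
Qed.

Lemma ip_normE x : ip x x = `|x| ^+ 2.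
Proof. by rewrite E_norm sqr_sqrtr// ip_ge0. Qed.

Lemma ip_normD a b x y :
  `|a *: x + b *: y| ^+ 2
  = a ^+ 2 * `|x| ^+ 2 + 2 * a * b * ip x y + b ^+ 2 * `|y| ^+ 2.
Proof.
rewrite -!ip_normE !(ipDl, ipDr, ipZl, ipZr) [B y x]B_sym; ring.
Qed.

Lemma cauchy_schwarz x y : `|ip x y| <= `|x| * `|y|.
Proof.
have [->|y0] := eqVneq y 0; first by rewrite linear0 normr0 mulr_ge0.
have ny : 0 < `|y| by rewrite normr_gt0.
rewrite -ler_sqr ?nnegrE ?mulr_ge0// exprMn real_normK ?num_real//.
have := sqr_ge0 `|(`|y| ^+ 2) *: x + (- ip x y) *: y|.
rewrite ip_normD.
rewrite (_ : _ + _ = `|y| ^+ 2 * (`|x| ^+ 2 * `|y| ^+ 2 - ip x y ^+ 2)); last by ring.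
by rewrite pmulr_rge0 ?exprn_gt0// subr_ge0.
Qed.

(** Riesz representation; surjectivity of [B] is a dimension count. *)
Lemma riesz (l : 'Hom(E, R^o)) : exists z, l = B z.
Proof.
have kB : lker B = 0%VS.
  apply/eqP; rewrite -subv0; apply/subvP => x; rewrite memv_ker memv0 => /eqP Bx.
  by apply/negPn/negP => /B_pos; rewrite Bx zero_lfunE ltxx.
have : limg B == fullv.
  rewrite eqEdim subvf /= limg_dim_eq ?kB ?capv0// !dimvf.
  by rewrite /dim /= muln1.
move=> /eqP fB; have : l \in limg B by rewrite fB memvf.
by move=> /memv_imgP[z _ ->]; exists z.
Qed.

Lemma linear_form_bounded (l : 'Hom(E, R^o)) :
  exists K : R, forall h, `|l h : R| <= K * `|h|.
Proof. by have [z ->] := riesz l; exists `|z| => h; exact: cauchy_schwarz. Qed.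

(** A family of linear forms on [E], bounded at each vector by a multiple of
    [N], is bounded uniformly on the unit ball by a multiple of [N]. *)
Lemma linear_family_bounded (Y : Type) (N : Y -> R) (F : E -> Y -> R) :
  (forall y : Y, 0 <= N y) -> (forall y : Y, scalar (F^~ y)) ->
  (forall x, exists K : R, forall y : Y, `|F x y| <= K * N y) ->
  exists K : R, forall x (y : Y), `|F x y| <= K * `|x| * N y.
Proof.
move=> N0 Flin /choice[K FK].
pose X := vbasis {:E}.
have /choice[C XC] : forall i, exists C : R, forall h, `|coord X i h| <= C * `|h|.
  move=> i; have [C CP] := linear_form_bounded (linfun (coord X i : E -> R^o)).
  by exists C => h; have := CP h; rewrite lfunE.
exists (\sum_i C i * K X`_i) => x y.
have F0 : F 0 y = 0.
  by have := Flin y (-1) 0 0; rewrite scaler0 addr0 mulN1r addNr.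
have Fsum (I : Type) (r : seq I) (a : I -> R) (v : I -> E) :
    F (\sum_(i <- r) a i *: v i) y = \sum_(i <- r) a i * F (v i) y.
  elim: r => [|i r IH]; first by rewrite !big_nil.
  by rewrite !big_cons (Flin y) IH.
rewrite [x in F x](coord_vbasis (memvf x)) Fsum.
apply: le_trans (ler_norm_sum _ _ _) _.
rewrite -mulrA mulr_suml; apply: ler_sum => i _.
rewrite normrM mulrACA ler_pM//; exact: XC.
Qed.

(** Symmetry is imposed through two transpositions that generate the
    permutations of the arguments; linearity in the last argument then gives
    linearity in each. *)
Definition symmetric_trilinear (T : E -> E -> E -> R) :=
  [/\ forall x y z, T x y z = T y x z, forall x y z, T x y z = T x z y
    & forall x y, scalar (T x y)].

Lemma trilinear3 T a b x y u v : symmetric_trilinear T ->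
  T x y (a *: u + b *: v) = a * T x y u + b * T x y v.
Proof.
case=> _ _ Tlin.
have T0 : T x y 0 = 0.
  by have := Tlin x y (-1) 0 0; rewrite scaler0 addr0 mulN1r addNr.
by rewrite Tlin -[b *: v]addr0 Tlin T0 addr0.
Qed.

Lemma trilinear2 T a b x y u v : symmetric_trilinear T ->
  T x (a *: u + b *: v) y = a * T x u y + b * T x v y.
Proof.
move=> Tst; have [_ T23 _] := Tst.
by rewrite T23 trilinear3// (T23 x u) (T23 x v).
Qed.

Lemma trilinear1 T a b x y u v : symmetric_trilinear T ->
  T (a *: u + b *: v) x y = a * T u x y + b * T v x y.
Proof.
move=> Tst; have [T12 _ _] := Tst.
by rewrite T12 trilinear2// (T12 x u) (T12 x v).
Qed.

Lemma trilinear_scale3 T a x y v : symmetric_trilinear T ->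
  T x y (a *: v) = a * T x y v.
Proof.
by move=> /(trilinear3 a 0 x y v v); rewrite scale0r mul0r !addr0.
Qed.

Lemma trilinear_scale1 T a x y v : symmetric_trilinear T ->
  T (a *: v) x y = a * T v x y.
Proof.
by move=> /(trilinear1 a 0 x y v v); rewrite scale0r mul0r !addr0.
Qed.

Lemma trilinear_scale2 T a x y v : symmetric_trilinear T ->
  T x (a *: v) y = a * T x v y.
Proof.
by move=> /(trilinear2 a 0 x y v v); rewrite scale0r mul0r !addr0.
Qed.

Lemma symmetric_trilinearB T S :
  symmetric_trilinear T -> symmetric_trilinear S ->
  symmetric_trilinear (fun x y z => T x y z - S x y z).
Proof.
move=> [T12 T23 Tl] [S12 S23 Sl]; split=> [x y z|x y z|x y a u v].
- by rewrite T12 S12.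
- by rewrite T23 S23.
- by rewrite Tl Sl; ring.
Qed.

(** The increment of a cubic form's gradient, exact at the midpoint. *)
Lemma trilinear_increment T u w : symmetric_trilinear T ->
  T (u + w) (u + w) w - T u u w = 2 * T (2^-1 *: (u + (u + w))) w w.
Proof.
move=> Tst; have [T12 T23 _] := Tst.
have -> : 2^-1 *: (u + (u + w)) = 1 *: u + 2^-1 *: w.
  by rewrite addrA scalerDr -mulr2n -[u *+ 2]scaler_nat scalerA mulVf.
have -> : u + w = 1 *: u + 1 *: w by rewrite !scale1r.
rewrite !trilinear1// !trilinear2// (T12 w u w).
by move: (T _ _ _) (T _ _ _) (T _ _ _) => *; field.
Qed.

(** Along an orthonormal frame, a symmetric trilinear form bounded by [K] on
    the cubes of unit vectors is bounded by [K] at [h, u, u], where [u] and [h]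
    have angles [-beta] and [2 beta] with the first vector of the frame: the
    value is a combination of three cubes, in directions 120 degrees apart,
    whose nonnegative weights have sum 1. *)
Lemma trilinear_frame_bound (T : E -> E -> E -> R) (K c s : R) (e w : E) :
  symmetric_trilinear T -> (forall v, `|v| = 1 -> `|T v v v| <= K) ->
  `|e| = 1 -> `|w| = 1 -> ip e w = 0 -> c ^+ 2 + s ^+ 2 = 1 ->
  `|T ((c ^+ 2 - s ^+ 2) *: e + (2 * c * s) *: w)
      (c *: e + (- s) *: w) (c *: e + (- s) *: w)| <= K.
Proof.
move=> Tst TK e1 w1 ew cs; have [T12 T23 _] := Tst.
pose r : R := Num.sqrt 3 / 2.
have r2 : r ^+ 2 = 3 / 4 by rewrite /r expr_div_n sqr_sqrtr//; field.
have unit_v (q : R) : q ^+ 2 = 3 / 4 -> `|(- (1 / 2)) *: e + q *: w| = 1.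
  move=> q2; apply/eqP; rewrite -(@eqrXn2 _ 2)// ip_normD e1 w1 ew q2.
  by apply/eqP; field.
have TE a b : T (a *: e + b *: w) (a *: e + b *: w) (a *: e + b *: w) =
    a ^+ 3 * T e e e + 3 * a ^+ 2 * b * T e e w + 3 * a * b ^+ 2 * T e w w
    + b ^+ 3 * T w w w.
  rewrite trilinear1// !trilinear2// !trilinear3//.
  rewrite (T12 w e e) (T23 e w e) (T12 w e w) (T23 w w e) (T12 w e w); ring.
have := TK _ (unit_v r r2); have := TK _ (unit_v (- r) _); rewrite sqrrN => /(_ r2).
have := TK e e1; rewrite !TE; set A := T e e e.
set Tm := (X in _ -> `|X| <= K -> _); set Tp := (X in _ -> _ -> `|X| <= K -> _).
move=> b0 bm bp.
(* With [c = cos beta] and [s = sin beta], these are [(1 + 2 cos g) / 3] for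
   [g] equal to [2 beta], [2 beta - 2 pi / 3] and [2 beta + 2 pi / 3]; the
   weights of the three cubes are their squares. *)
pose m0 := (3 * c ^+ 2 - s ^+ 2) / 3.
pose mp := (2 * s ^+ 2 + 4 * r * c * s) / 3.
pose mm := (2 * s ^+ 2 - 4 * r * c * s) / 3.
have -> : T ((c ^+ 2 - s ^+ 2) *: e + (2 * c * s) *: w)
      (c *: e + (- s) *: w) (c *: e + (- s) *: w) =
    m0 ^+ 2 * A + mp ^+ 2 * Tp + mm ^+ 2 * Tm.
  rewrite trilinear1// !trilinear2// !trilinear3//.
  rewrite (T12 w e e) (T23 e w e) (T12 w e w) (T23 w w e) (T12 w e w).
  rewrite -/A; move: (T e e w) (T e w w) (T w w w) @Tm @Tp bm bp.
  move=> T1 T2 T3 Tm Tp _ _.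
  (* Parts even and odd in [r], so that only [r ^+ 2 = 3 / 4] remains. *)
  pose P := - (1 / 8) * A - 9 / 8 * T2; pose Q := 3 / 4 * (T1 + T3).
  pose p := (4 * s ^+ 4 + 12 * c ^+ 2 * s ^+ 2) / 9.
  pose q := 16 / 9 * c * s ^+ 3.
  have r3 : r ^+ 3 = 3 / 4 * r by rewrite exprS r2 mulrC.
  have -> : Tp = P + r * Q by rewrite /Tp r2 r3 /P /Q; field.
  have -> : Tm = P - r * Q.
    have rN3 : (- r) ^+ 3 = - (3 / 4 * r) by rewrite -r3; ring.
    by rewrite /Tm (sqrrN r) r2 rN3 /P /Q; field.
  have -> : mp ^+ 2 = p + r * q.
    rewrite (_ : _ ^+ 2 = (4 * s ^+ 4 + 16 * r * c * s ^+ 3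
      + 16 * r ^+ 2 * c ^+ 2 * s ^+ 2) / 9); last by rewrite /mp; field.
    by rewrite r2 /p /q; field.
  have -> : mm ^+ 2 = p - r * q.
    rewrite (_ : _ ^+ 2 = (4 * s ^+ 4 - 16 * r * c * s ^+ 3
      + 16 * r ^+ 2 * c ^+ 2 * s ^+ 2) / 9); last by rewrite /mm; field.
    by rewrite r2 /p /q; field.
  rewrite [RHS](_ : _ = m0 ^+ 2 * A + 2 * p * P + 2 * r ^+ 2 * q * Q); last by ring.
  by rewrite r2 /m0 /p /q /P /Q; field.
have sum1 : m0 ^+ 2 + mp ^+ 2 + mm ^+ 2 = 1.
  rewrite -[RHS](expr1n _ 2) -cs /m0 /mp /mm.
  rewrite (_ : _ + _ = ((3 * c ^+ 2 - s ^+ 2) ^+ 2 + 8 * s ^+ 4 +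
    32 * r ^+ 2 * c ^+ 2 * s ^+ 2) / 9); last by field.
  by rewrite r2; field.
apply: le_trans (ler_normD _ _) _.
apply: le_trans (lerD (ler_normD _ _) (lexx _)) _.
have nM (a b : R) : `|a ^+ 2 * b| = a ^+ 2 * `|b|.
  by rewrite normrM ger0_norm ?sqr_ge0.
rewrite !nM -[K]mul1r -sum1 !mulrDl.
by rewrite !lerD// ler_wpM2l// sqr_ge0.
Qed.

(** A unit vector of angle [3 beta], in coordinates: [c = cos beta] and
    [s = sin beta]. *)
Lemma trisect_angle (a b : R) : 0 <= b -> a ^+ 2 + b ^+ 2 = 1 ->
  exists c s : R, [/\ c ^+ 2 + s ^+ 2 = 1, a = c ^+ 3 - 3 * c * s ^+ 2
    & b = 3 * c ^+ 2 * s - s ^+ 3].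
Proof.
move=> b0 ab.
have a1 : -1 <= a <= 1.
  by rewrite -ler_norml -(@ler_sqr _ `|a|) ?nnegrE// expr1n real_normK ?num_real//; nra.
pose al := acos a.
have cal : cos al = a by rewrite acosK// in_itv.
have sal : sin al = b.
  by rewrite sin_acos// -ab addrAC subrr add0r sqrtr_sqr ger0_norm.
have E3 : al = al / 3 + al / 3 + al / 3 by field.
exists (cos (al / 3)), (sin (al / 3)); split; first exact: cos2Dsin2.
- by rewrite -cal [al in LHS]E3 !(cosD, sinD); ring.
- by rewrite -sal [al in LHS]E3 !(cosD, sinD); ring.
Qed.

(** Banach's theorem for cubic forms: the mixed values of a symmetric
    trilinear form are controlled by its values on the diagonal. *)
Lemma trilinear_diag_bound (T : E -> E -> E -> R) (K : R) h u :
  symmetric_trilinear T -> (forall v, `|T v v v| <= K * `|v| ^+ 3) ->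
  `|T h u u| <= K * `|h| * `|u| ^+ 2.
Proof.
move=> Tst TK.
have TK1 v : `|v| = 1 -> `|T v v v| <= K.
  by move=> v1; have := TK v; rewrite v1 expr1n mulr1.
have [u0|u0] := eqVneq u 0.
  by rewrite u0 -(scale0r u) trilinear_scale3// mul0r !normr0 scale0r normr0 expr0n mulr0.
have [h0|h0] := eqVneq h 0.
  by rewrite h0 -(scale0r u) trilinear_scale1// mul0r !normr0 scale0r normr0 mulr0 mul0r.
suff unit_bound h' u' : `|h'| = 1 -> `|u'| = 1 -> `|T h' u' u'| <= K.
  have unitV v : v != 0 -> `| `|v|^-1 *: v| = 1.
    by move=> v0; rewrite normrZ normfV normr_id mulVf ?normr_eq0.
  have := unit_bound _ _ (unitV h h0) (unitV u u0).
  rewrite trilinear_scale1// trilinear_scale2// trilinear_scale3//.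
  have nh : 0 < `|h| by rewrite normr_gt0.
  have nu : 0 < `|u| by rewrite normr_gt0.
  rewrite !normrM !normfV !normr_id !ler_pdivrMl//.
  by move=> H; rewrite (le_trans H)// le_eqVlt; apply/orP; left; apply/eqP; ring.
move=> h1 u1; pose a : R := ip u' h'; pose z := h' - a *: u'.
have z2 : a ^+ 2 + `|z| ^+ 2 = 1.
  have -> : z = 1 *: h' + (- a) *: u' by rewrite scale1r scaleNr.
  by rewrite ip_normD h1 u1 [ip h' u']B_sym -/a; ring.
(* When [h'] and [u'] are collinear, the ambient space may contain no unit
   vector orthogonal to [u']. *)
have [z0|z0] := eqVneq z 0.
  have hE : h' = a *: u' by apply/eqP; rewrite -subr_eq0 -/z z0.
  rewrite hE trilinear_scale1// normrM.
  apply: le_trans (TK1 _ u1); rewrite ler_piMl//.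
  by have := cauchy_schwarz u' h'; rewrite h1 u1 mulr1.
pose w0 := `|z|^-1 *: z.
have nz : `|z| != 0 by rewrite normr_eq0.
have w01 : `|w0| = 1 by rewrite normrZ normfV normr_id mulVf.
have uw0 : ip u' w0 = 0.
  by rewrite ipZr /z -scaleNr ipDr ipZr ip_normE u1 -/a expr1n mulr1 subrr mulr0.
have zE : z = `|z| *: w0 by rewrite /w0 scalerA mulfV// scale1r.
clearbody w0.
have [c [s [cs ac zs]]] := trisect_angle (normr_ge0 z) z2.
(* The frame is [(u', w0)] turned by a third of the angle from [u'] to [h']. *)
pose e := c *: u' + s *: w0; pose w := (- s) *: u' + c *: w0.
have e1 : `|e| = 1.
  by apply/eqP; rewrite -(@eqrXn2 _ 2)// ip_normD u1 w01 uw0 !expr1n !mulr1 mulr0 addr0 cs.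
have w1 : `|w| = 1.
  apply/eqP; rewrite -(@eqrXn2 _ 2)// ip_normD u1 w01 uw0 !expr1n !mulr1 mulr0.
  by rewrite addr0 sqrrN addrC cs.
have ew : ip e w = 0.
  rewrite !(ipDl, ipDr, ipZl, ipZr) !ip_normE u1 w01 [ip w0 u']B_sym uw0; ring.
have := trilinear_frame_bound Tst TK1 e1 w1 ew cs.
have -> : c *: e + (- s) *: w = u'.
  rewrite /e /w !scalerDr !scalerA addrACA -!scalerDl.
  rewrite [X in X *: u'](_ : _ = 1); last by rewrite -cs; ring.
  by rewrite [X in X *: w0](_ : _ = 0) ?scale1r ?scale0r ?addr0//; ring.
have -> // : (c ^+ 2 - s ^+ 2) *: e + (2 * c * s) *: w = h'.
rewrite /e /w !scalerDr !scalerA addrACA -!scalerDl.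
have -> : h' = a *: u' + `|z| *: w0.
  by rewrite -zE addrC subrK.
by rewrite ac zs; congr (_ *: _ + _ *: _); ring.
Qed.

Lemma bilinear_bounded (Q : E -> E -> R) :
  (forall x y, Q x y = Q y x) -> (forall x, scalar (Q x)) ->
  exists K : R, forall x y, `|Q x y| <= K * `|x| * `|y|.
Proof.
move=> Qsym Qlin.
apply: (@linear_family_bounded E (fun y => `|y|) Q) => // [y a u v|x].
  by rewrite !(Qsym _ y) Qlin.
have [] := @linear_family_bounded unit (fun=> 1) (fun y _ => Q x y) => //.
- by move=> y; exists `|Q x y| => _; rewrite mulr1.
- by move=> K QK; exists K => y; have := QK y tt; rewrite mulr1.
Qed.

Lemma trilinear_bounded (T : E -> E -> E -> R) : symmetric_trilinear T ->
  exists K : R, forall x y z, `|T x y z| <= K * `|x| * `|y| * `|z|.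
Proof.
move=> Tst; have [T12 T23 Tlin] := Tst.
have [] := @linear_family_bounded (E * E) (fun p => `|p.1| * `|p.2|)
  (fun x p => T x p.1 p.2).
- by move=> p; rewrite mulr_ge0.
- by move=> p a u v; rewrite -[v in LHS]scale1r trilinear1// mul1r.
- move=> x; have [K KP] := bilinear_bounded (T23 x) (Tlin x).
  by exists K => p; rewrite mulrA.
- by move=> K KP; exists K => x y z; have := KP x (y, z); rewrite /= mulrA.
Qed.

(** Linear forms on [E] are continuous, so that a quadratic remainder suffices
    for Frechet differentiability. *)
Lemma is_diff_quadratic_remainder (f l : E -> R) x (C : R) : scalar l ->
  (forall h, `|h| <= 1 -> `|f (x + h) - f x - l h| <= C * `|h| ^+ 2) ->
  is_diff x f l.
Proof.
move=> llin fC.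
pose L : {linear E -> R^o} := HB.pack l (GRing.isLinear.Build _ _ _ _ l llin).
have [K LK] := linear_form_bounded (linfun L).
apply: (@is_diff_expansion R E f x L K) => [h|e e0].
  by have := LK h; rewrite lfunE.
exists (Num.min 1 (e / (`|C| + 1))).
  by rewrite lt_min ltr01 divr_gt0// ltr_wpDl.
move=> h; rewrite lt_min ltr_pdivlMr ?ltr_wpDl// => /andP[/ltW h1 he].
rewrite (le_trans (fC _ h1))// expr2 mulrA ler_wpM2r//.
have h0 := normr_ge0 h; rewrite mulrDr mulr1 in he.
apply: le_trans (_ : `|h| * `|C| <= _); last by lra.
by rewrite mulrC ler_wpM2l// ler_norm.
Qed.

Lemma is_diff_translate (f l : E -> R) x z :
  is_diff (z - x) f l -> is_diff z (fun y => f (y - x)) l.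
Proof.
move=> dl.
have ds : is_diff z (fun y : E => y - x) id by apply: is_diff_eq; rewrite subr0.
exact: (@is_diff_comp _ _ _ _ _ _ _ _ _ ds dl).
Qed.

Lemma is_diff_quadratic_form (Q : E -> E -> R) z :
  (forall x y, Q x y = Q y x) -> (forall x, scalar (Q x)) ->
  is_diff z (fun y => Q y y) (fun h => 2 * Q z h).
Proof.
move=> Qsym Qlin; have [K QK] := bilinear_bounded Qsym Qlin.
apply: (@is_diff_quadratic_remainder _ _ z K) => [a u v|h _].
  by rewrite Qlin; ring.
have QD x u v : Q x (u + v) = Q x u + Q x v by rewrite -[u]scale1r Qlin mul1r scale1r.
rewrite QD !(Qsym (z + h)) !QD (Qsym h z).
by rewrite (_ : _ - _ = Q h h) ?expr2 ?mulrA//; ring.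
Qed.

Lemma is_diff_cubic_form (T : E -> E -> E -> R) z : symmetric_trilinear T ->
  is_diff z (fun y => T y y y) (fun h => 3 * T z z h).
Proof.
move=> Tst; have [K TK] := trilinear_bounded Tst; have [T12 T23 Tlin] := Tst.
apply: (@is_diff_quadratic_remainder _ _ z (3 * K * `|z| + `|K|)) => [a u v|h h1].
  by rewrite Tlin; ring.
rewrite -[z + h](_ : 1 *: z + 1 *: h = _); last by rewrite !scale1r.
rewrite trilinear1// !trilinear2// !trilinear3//.
rewrite (T12 h z z) (T23 z h z) (T12 h z h) (T23 h h z) (T12 h z h).
rewrite (_ : _ - _ = 3 * T z h h + T h h h); last by ring.
rewrite [leRHS]mulrDl; apply: le_trans (ler_normD _ _) (lerD _ _).
  have := TK z h h; rewrite normrM ger0_norm// => H.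
  rewrite -!mulrA ler_pM2l// expr2; apply: le_trans H _; rewrite -!mulrA//.
apply: le_trans (TK h h h) _; rewrite -!mulrA -expr2.
apply: le_trans (_ : `|K| * (`|h| * `|h| ^+ 2) <= _).
  by rewrite ler_wpM2r ?ler_norm// mulr_ge0// exprn_ge0.
by rewrite ler_wpM2l// ler_piMl// exprn_ge0.
Qed.

Lemma is_diff_norm_powR (r : R) z : 2 < r ->
  is_diff z (fun y : E => `|y| `^ r) (fun h => r * `|z| `^ (r - 2) * ip z h).
Proof.
move=> r2.
have [->|z0] := eqVneq z 0.
  apply: (@is_diff_quadratic_remainder _ _ 0 1) => [a u v|h h1].
    by rewrite ipDr ipZr; ring.
  have r0 : r != 0 by rewrite gt_eqF//; lra.
  rewrite add0r normr0 powR0//.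
  rewrite (linear0 B) zero_lfunE mulr0 !subr0 mul1r ger0_norm ?powR_ge0//.
  have [->|h0] := eqVneq h 0.
    by rewrite normr0 powR0 ?expr0n.
  by rewrite -powR_mulrn//; apply: ger_powR; rewrite ?normr_gt0 ?h0// ltW.
have nz : 0 < `|z| by rewrite normr_gt0.
have -> : (fun y : E => `|y| `^ r) = (fun s : R => s `^ (r / 2)) \o (fun y => ip y y).
  apply/funext => y /=; rewrite ip_normE -powR_mulrn// -powRrM.
  by congr (_ `^ _); field.
have dq := @is_diff_quadratic_form (fun x y => ip x y) z B_sym (fun x => linearP _).
have p0 : 0 < ip z z by rewrite ip_normE exprn_gt0.
have [dp dpE] := is_derive1_powR (r / 2) p0.
have dp' : is_diff (ip z z) (fun s : R => s `^ (r / 2))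
    (fun s : R => s * (r / 2 * ip z z `^ (r / 2 - 1))).
  split; first exact/derivable1_diffP.
  rewrite diff1E; last exact/derivable1_diffP.
  by rewrite derive1E dpE.
apply: (is_diff_eq (@is_diff_comp _ _ _ _ _ _ _ _ _ dq dp')).
apply/funext => h /=; rewrite ip_normE -powR_mulrn// -powRrM.
rewrite (_ : 2 * (r / 2 - 1) = r - 2); last by field.
by field.
Qed.

End EuclideanSpace.

(** * Convexity and relative smoothness from gradients *)

Section Convexity.
Context {R : realType} {E : finNormedModType R}.
Implicit Types (f g : E -> R) (x y u v w h : E).

Lemma tangent_of_monotone_gradient g (dg : E -> E -> R) :
  (forall x, is_diff x g (dg x)) ->
  (forall u v, dg u (v - u) <= dg v (v - u)) ->
  forall u v, g u + dg u (v - u) <= g v.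
Proof.
move=> gdg mono u v.
have gd x : differentiable g x by case: (gdg x).
have dgE x h : 'd g x h = dg x h by have [_ ->] := gdg x.
have [s /andP[s0 s1]] := mean_value_line u (v - u) gd.
rewrite subrKC dgE => Es.
have := mono u (u + s *: (v - u)); rewrite addrAC subrr add0r.
have dZ z : dg z (s *: (v - u)) = s * dg z (v - u) by rewrite -!dgE linearZ.
by rewrite !dZ ler_pM2l// -Es lerBrDl.
Qed.

Lemma convex_of_monotone_gradient g (dg : E -> E -> R) :
  (forall x, is_diff x g (dg x)) ->
  (forall u v, dg u (v - u) <= dg v (v - u)) -> convex g.
Proof.
move=> gdg mono t u v _ _; set a : R := t%:num.
have t0 : 0 <= a by rewrite /a ge0.
have t1 : a <= 1 by rewrite /a le1.
pose z := a *: u + (1 - a) *: v.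
change (g z <= a * g u + (1 - a) * g v).
have zE : z = v + a *: (u - v).
  by rewrite /z scalerBl scale1r scalerBr [RHS]addrCA.
have Ev : v - z = - (a *: (u - v)) by rewrite zE opprD addrA subrr add0r.
have Eu : u - z = (u - v) - a *: (u - v) by rewrite zE opprD addrA.
have dZ c : dg z (c *: (u - v)) = c * dg z (u - v).
  by have [_ <-] := gdg z; rewrite linearZ.
have dEu : dg z (u - z) = (1 - a) * dg z (u - v).
  by rewrite Eu -{1}[u - v]scale1r -scalerBl dZ.
have dEv : dg z (v - z) = - a * dg z (u - v) by rewrite Ev -scaleNr dZ.
have tg := tangent_of_monotone_gradient gdg mono z.
have := tg u; have := tg v; rewrite dEu dEv.
by move: (dg z _) (g z) (g u) (g v) => D gz gu gv h1 h2; nra.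
Qed.

Lemma tangent_of_convex g u v : convex g -> differentiable g u ->
  g u + 'd g u (v - u) <= g v.
Proof.
move=> cg dg; apply/ler_addgt0Pl => e e0.
pose n := `|v - u| + 1.
have n0 : 0 < n by rewrite ltr_wpDl.
have [d d0 dP] := differentiable_expansion dg (divr_gt0 e0 n0).
pose s := Num.min 1 (d / (2 * n)).
have s0 : 0 < s by rewrite lt_min ltr01 divr_gt0// mulr_gt0.
have s1 : s <= 1 by rewrite ge_min lexx.
have sd : s * n < d.
  have : s <= d / (2 * n) by rewrite ge_min lexx orbT.
  rewrite ler_pdivlMr ?mulr_gt0//; lra.
have nn : `|v - u| < n by rewrite /n; lra.
have := cg (Itv01 (ltW s0) s1) v u; rewrite !inE => /(_ I I).
pose z := s *: v + (1 - s) *: u.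
change (g z <= s * g v + (1 - s) * g u -> g u + 'd g u (v - u) <= e + g v).
have -> : z = u + s *: (v - u).
  by rewrite /z scalerBl scale1r scalerBr [RHS]addrCA.
have ns : `|s *: (v - u)| = s * `|v - u| by rewrite normrZ gtr0_norm.
have dZ : 'd g u (s *: (v - u)) = s * 'd g u (v - u) by rewrite linearZ.
have := dP (s *: (v - u)); rewrite ns dZ.
have sn : s * `|v - u| < d by apply: le_lt_trans sd; rewrite ler_pM2l// ltW.
have en : e / n * (s * `|v - u|) <= s * e.
  rewrite mulrCA ler_pM2l// -mulrA [_^-1 * _]mulrC ler_piMr ?(ltW e0)//.
  by rewrite ler_pdivrMr// mul1r ltW.
move=> /(_ sn); rewrite ler_norml => /andP[h1 _] h2.
rewrite -(ler_pM2l s0) !mulrDr; lra.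
Qed.

(** When the gradient of [a *: g + b *: k] is monotone, this function lies above
    its tangents. *)
Lemma combination_tangent g k (dg dk : E -> E -> R) (a b : R) :
  (forall x, is_diff x g (dg x)) -> (forall x, is_diff x k (dk x)) ->
  (forall u v, a * dg u (v - u) + b * dk u (v - u)
    <= a * dg v (v - u) + b * dk v (v - u)) ->
  forall u v, (a * g u + b * k u) + (a * dg u (v - u) + b * dk u (v - u))
    <= a * g v + b * k v.
Proof.
move=> gdg kdk mono.
have D z : is_diff z (a *: g + b *: k) (fun h => a * dg z h + b * dk z h).
  exact: (is_diffD (is_diffZ a (gdg z)) (is_diffZ b (kdk z))).
exact: (tangent_of_monotone_gradient D mono).
Qed.

Lemma relatively_smooth_of_gradient g k (dg dk : E -> E -> R) (L : R) :
  (forall x, is_diff x g (dg x)) -> (forall x, is_diff x k (dk x)) -> convex k ->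
  (forall u v, dg v (v - u) - dg u (v - u) <= L * (dk v (v - u) - dk u (v - u))) ->
  relatively_smooth g k L.
Proof.
move=> gdg kdk ck gk; split => // u v.
have mono y z : -1 * dg y (z - y) + L * dk y (z - y)
    <= -1 * dg z (z - y) + L * dk z (z - y) by have := gk y z; lra.
have := combination_tangent gdg kdk mono u v.
by have [_ ->] := gdg u; rewrite /bregman; have [_ ->] := kdk u; lra.
Qed.

Lemma relatively_strongly_convex_of_gradient g k (dg dk : E -> E -> R) (mu : R) :
  (forall x, is_diff x g (dg x)) -> (forall x, is_diff x k (dk x)) -> convex k ->
  0 <= mu ->
  (forall u v, mu * (dk v (v - u) - dk u (v - u)) <= dg v (v - u) - dg u (v - u)) ->
  relatively_strongly_convex g k mu.
Proof.
move=> gdg kdk ck mu0 gk; split => // u v.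
have mono y z : 1 * dg y (z - y) + - mu * dk y (z - y)
    <= 1 * dg z (z - y) + - mu * dk z (z - y) by have := gk y z; lra.
have := combination_tangent gdg kdk mono u v.
by have [_ ->] := gdg u; rewrite /bregman; have [_ ->] := kdk u; lra.
Qed.

End Convexity.

(** * Second and third derivatives of the objective *)

Lemma powR1D (R : realType) (a p : R) : 0 <= a -> 0 <= p ->
  a `^ (1 + p) = a * a `^ p.
Proof.
move=> a0 p0; rewrite -(@mulr_powRB1 _ _ (1 + p)) ?ltr_wpDr//.
by congr (_ * _ `^ _); ring.
Qed.

Section SecondThirdDerivatives.
Context {R : realType} {E : finNormedModType R}.
Context {f : E -> R}.
Hypothesis f_diff : thrice_differentiable f.
Implicit Types (x y u v h : E).

Lemma D2_scalar x h : scalar (D2 f x h).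
Proof. by move=> a u v; rewrite /D2 linearP. Qed.

Lemma D2_sym x h k : D2 f x h k = D2 f x k h.
Proof. by have [d1 d2 _] := f_diff; apply: diff_diff_sym => // h'; exact: d2. Qed.

Lemma D3_symmetric_trilinear x : symmetric_trilinear (D3 f x).
Proof.
have [d1 d2 d3] := f_diff; split.
- move=> h1 h2 h3; rewrite /D3.
  by rewrite (_ : (fun y => D2 f y h1 h2) = fun y => D2 f y h2 h1)//;
    apply/funext => y; exact: D2_sym.
- move=> h1 h2 h3.
  by apply: (@diff_diff_sym _ _ (fun y => 'd f y h1)) => [y|h]; [exact: d2|exact: d3].
- by move=> h1 h2 a u v; rewrite /D3 linearP.
Qed.

Lemma D2_convex_ge0 x u : convex f -> 0 <= D2 f x u u.
Proof.
move=> cf; have [d1 d2 _] := f_diff.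
have mono (t : R) : 0 < t -> 'd f x u <= 'd f (x + t *: u) u.
  move=> t0; have := tangent_of_convex (x + t *: u) cf (d1 x).
  have := tangent_of_convex x cf (d1 (x + t *: u)).
  rewrite [x + t *: u - x]addrAC subrr add0r opprD addrA subrr add0r.
  have -> : 'd f x (t *: u) = t * 'd f x u by rewrite linearZ.
  have -> : 'd f (x + t *: u) (- (t *: u)) = - t * 'd f (x + t *: u) u.
    by rewrite -scaleNr linearZ.
  rewrite -(ler_pM2l t0 ('d f x u)).
  by move: ('d f x u : R) ('d f _ u : R) (f x) (f _) => *; lra.
apply/ler_addgt0Pl => e e0.
pose n := `|u| + 1.
have n0 : 0 < n by rewrite ltr_wpDl.
have [d d0 dP] := differentiable_expansion (d2 u x) (divr_gt0 e0 n0).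
pose t := d / (2 * n).
have t0 : 0 < t by rewrite divr_gt0// mulr_gt0.
have nt : `|t *: u| = t * `|u| by rewrite normrZ gtr0_norm.
have un : `|u| <= n by rewrite /n; lra.
have td : t * `|u| < d.
  apply: (@le_lt_trans _ _ (t * n)); first by rewrite ler_pM2l.
  rewrite (_ : t * n = d / 2); first lra.
  by rewrite /t; field; rewrite gt_eqF.
have dG : 'd (fun y => 'd f y u) x (t *: u) = t * D2 f x u u by exact: linearZ.
have dPt : `|'d f (x + t *: u) u - 'd f x u - t * D2 f x u u| <= e / n * (t * `|u|).
  by rewrite -dG -nt; apply: dP; rewrite nt.
move: dPt; rewrite ler_norml => /andP[_].
have en : e / n * (t * `|u|) <= t * e.
  rewrite mulrCA ler_pM2l// -mulrA [_^-1 * _]mulrC ler_piMr ?(ltW e0)//.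
  by rewrite ler_pdivrMr// mul1r.
move: (mono t t0) en; rewrite -(ler_pM2l t0 0) mulr0 mulrDr.
by move: ('d f x u : R) ('d f _ u : R) (D2 _ _ _ _) (e / n * _) => *; lra.
Qed.

Context {B : 'Hom(E, 'Hom(E, R^o))}.
Hypotheses (B_sym : self_adjoint B) (B_pos : positive_definite B)
  (E_norm : normed_by B).

(** The supremum defining [trinorm] is over a bounded set, hence not a default
    value. *)
Lemma trinorm_bound (T : E -> E -> E -> R) v : symmetric_trilinear T ->
  `|T v v v| <= trinorm T * `|v| ^+ 3.
Proof.
move=> Tst; have [K TK] := trilinear_bounded B_sym B_pos E_norm Tst.
have ub : has_ubound [set `|T h h h| | h in [set h : E | `|h| <= 1]]%classic.
  exists `|K| => _ [h /= h1 <-]; apply: le_trans (TK h h h) _.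
  rewrite -!mulrA; apply: le_trans (_ : `|K| * (`|h| * (`|h| * `|h|)) <= _).
    by rewrite ler_wpM2r ?ler_norm// !mulr_ge0.
  by rewrite ler_piMr// !mulr_ile1// ?mulr_ge0.
have [->|v0] := eqVneq v 0.
  by rewrite -(scale0r v) trilinear_scale1// mul0r scale0r !normr0 expr0n mulr0.
have nv : 0 < `|v| by rewrite normr_gt0.
have unitv : `| `|v|^-1 *: v| <= 1.
  by rewrite normrZ normfV normr_id mulVf ?normr_eq0.
have : `|T (`|v|^-1 *: v) (`|v|^-1 *: v) (`|v|^-1 *: v)| <= trinorm T.
  by apply: ub_le_sup => //; exists (`|v|^-1 *: v).
rewrite trilinear_scale1// trilinear_scale2// trilinear_scale3//.
rewrite !normrM !normfV !normr_id !ler_pdivrMl// => H.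
by apply: le_trans H _; rewrite le_eqVlt /trinorm; apply/orP; left; apply/eqP; ring.
Qed.

Context {nu Hf : R}.
Hypotheses (nu0 : 0 <= nu) (Hf_gt0 : 0 < Hf) (f_hoelder : D3_hoelder f nu Hf).

Lemma D3_hoelder_mixed x y h u :
  `|D3 f y h u u - D3 f x h u u| <= Hf * `|y - x| `^ nu * `|h| * `|u| ^+ 2.
Proof.
have Tst := symmetric_trilinearB (D3_symmetric_trilinear y) (D3_symmetric_trilinear x).
have TK v := trinorm_bound v Tst.
apply: le_trans (trilinear_diag_bound B_sym B_pos E_norm h u Tst TK) _.
by rewrite -[leLHS]mulrA -[leRHS]mulrA ler_wpM2r ?mulr_ge0 ?exprn_ge0//; exact: f_hoelder.
Qed.

(** The mean value theorem gives this with constant [Hf]; integration would give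
    [Hf / (1 + nu)], which is not needed. *)
Lemma D2_taylor x h u :
  `|D2 f (x + h) u u - D2 f x u u - D3 f x h u u|
    <= Hf * `|h| `^ (1 + nu) * `|u| ^+ 2.
Proof.
have [_ _ d3] := f_diff.
have st y v : D3 f y u u v = D3 f y v u u.
  by have [T12 T23 _] := D3_symmetric_trilinear y; rewrite T23 T12.
have [s /andP[s0 s1] ->] := mean_value_line x h (d3 u u).
rewrite -/(D3 f _ u u h) st; apply: le_trans (D3_hoelder_mixed _ _ _ _) _.
rewrite [x + s *: h]addrC addrK ler_wpM2r ?exprn_ge0//.
rewrite -mulrA ler_pM2l//.
rewrite powR1D// [leRHS]mulrC.
rewrite ler_wpM2r// ge0_ler_powR ?nnegrE// normrZ gtr0_norm//.
by rewrite ler_piMl// ltW.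
Qed.

(** The second derivatives at [x + t *: h] and [x - t *: h] are nonnegative. *)
Lemma D3_convex_bound x h u (t : R) : convex f -> 0 < t ->
  `|D3 f x h u u| <= D2 f x u u / t + t `^ nu * Hf * (`|h| `^ (1 + nu) * `|u| ^+ 2).
Proof.
move=> cf t0; set C := `|h| `^ _ * _.
have tp : t `^ (1 + nu) = t * t `^ nu by rewrite powR1D// ltW.
have bound (s : R) : `|s| = t -> 0 <= D2 f x u u + s * D3 f x h u u + t * (t `^ nu * Hf * C).
  move=> st; have := D2_taylor x (s *: h) u.
  rewrite trilinear_scale1; last exact: D3_symmetric_trilinear.
  rewrite ler_norml => /andP[_].
  rewrite normrZ st powRM ?(ltW t0)// tp => h1.
  have := D2_convex_ge0 (x + s *: h) u cf; move: h1; rewrite -/C.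
  rewrite [Hf * _ * _](_ : _ = t * (t `^ nu * Hf * C)); last by rewrite /C; ring.
  by move: (D2 _ _ _ _) (D2 _ _ _ _) (D3 _ _ _ _ _) (t * _) => *; lra.
have b1 := bound t (gtr0_norm t0).
have b2 := bound (- t) (etrans (normrN t) (gtr0_norm t0)).
have -> : D2 f x u u / t + t `^ nu * Hf * C =
    (D2 f x u u + t * (t `^ nu * Hf * C)) / t.
  by field; rewrite gt_eqF.
rewrite ler_pdivlMr// -[X in _ * X](gtr0_norm t0) -normrM ler_norml.
move: b1 b2; move: (D2 _ _ _ _) (D3 _ _ _ _ _) (t * (_ * C)) => *.
by apply/andP; split; lra.
Qed.

End SecondThirdDerivatives.

(** * Gradients of the model and of the scaling function *)

Section RelativeSmoothness.
Context {R : realType} {E : finNormedModType R}.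
Context {B : 'Hom(E, 'Hom(E, R^o))}.
Hypotheses (B_sym : self_adjoint B) (B_pos : positive_definite B)
  (E_norm : normed_by B).
Implicit Types (x y u v w h a b : E).

Local Notation ip x y := (B x y : R).

(** The gradient of [(2 + p)^-1 * |.| ^ (2 + p)] is strongly monotone, with a
    modulus depending on the midpoint: the right-hand side equals
    [(|a| ^ p + |b| ^ p) / 2 * |b - a| ^ 2
     + (|b| ^ p - |a| ^ p) * (|b| ^ 2 - |a| ^ 2) / 2],
    whose second term is nonnegative. *)
Lemma norm_powR_gradient_monotone (p : R) a b : 1 <= p ->
  `|2^-1 *: (a + b)| `^ p * `|b - a| ^+ 2
    <= `|b| `^ p * ip b (b - a) - `|a| `^ p * ip a (b - a).
Proof.
move=> p1; have p0 : 0 <= p by lra.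
have mid : `|2^-1 *: (a + b)| `^ p <= (`|a| `^ p + `|b| `^ p) / 2.
  have h0 : 0 <= 2^-1 :> R by [].
  have h1 : 2^-1 <= 1 :> R by lra.
  have := convex_powR p1 (Itv01 h0 h1) (_ : `|a| \in _) (_ : `|b| \in _).
  rewrite !inE /= !in_itv /= !normr_ge0 => /(_ isT isT).
  change ((2^-1 * `|a| + (1 - 2^-1) * `|b|) `^ p <=
    2^-1 * `|a| `^ p + (1 - 2^-1) * `|b| `^ p ->
    `|2^-1 *: (a + b)| `^ p <= (`|a| `^ p + `|b| `^ p) / 2).
  move=> H; apply: le_trans (_ : _ <= (2^-1 * `|a| + (1 - 2^-1) * `|b|) `^ p) _; last lra.
  apply: ge0_ler_powR => //; rewrite ?nnegrE//.
    by rewrite addr_ge0 ?mulr_ge0//; lra.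
  rewrite normrZ ger0_norm//; have := ler_normD a b; lra.
have Nw : `|b - a| ^+ 2 = `|b| ^+ 2 - 2 * ip a b + `|a| ^+ 2.
  have -> : b - a = 1 *: b + (-1) *: a by rewrite scale1r scaleN1r.
  by rewrite (ip_normD B_sym B_pos E_norm) [B b a]B_sym; ring.
have Eb : ip b (b - a) = `|b| ^+ 2 - ip a b.
  by rewrite linearB /= (ip_normE B_sym B_pos E_norm) [B b a]B_sym.
have Ea : ip a (b - a) = ip a b - `|a| ^+ 2.
  by rewrite linearB /= (ip_normE B_sym B_pos E_norm).
rewrite Eb Ea.
have powR_le (c d : R) : 0 <= c -> c <= d -> c `^ p <= d `^ p.
  by move=> c0 cd; apply: ge0_ler_powR => //; rewrite nnegrE// (le_trans c0).
have cross : 0 <= (`|b| `^ p - `|a| `^ p) * (`|b| ^+ 2 - `|a| ^+ 2).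
  have [ab|/ltW ba] := leP `|a| `|b|.
    by apply: mulr_ge0; rewrite subr_ge0 ?ler_sqr ?nnegrE ?powR_le.
  by apply: mulr_le0; rewrite subr_le0 ?ler_sqr ?nnegrE ?powR_le.
apply: le_trans (ler_wpM2r (exprn_ge0 2 (normr_ge0 _)) mid) _.
move: cross; rewrite Nw; move: (_ `^ p) (_ `^ p) (`|b| ^+ 2) (ip a b) (`|a| ^+ 2).
by move=> *; lra.
Qed.

Context {f : E -> R} {nu Hf : R}.
Hypotheses (f_convex : convex f) (f_diff : thrice_differentiable f)
  (nu01 : 0 <= nu <= 1) (Hf_gt0 : 0 < Hf) (f_hoelder : D3_hoelder f nu Hf).

Let r3 : 2 < 3 + nu. Proof. by case/andP: nu01 => *; lra. Qed.
Let r3E : 3 + nu - 2 = 1 + nu. Proof. by ring. Qed.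

(** [rho_gradient x z h] and [Omega_gradient x H z h] are the derivatives of
    [rho f x nu] and [Omega f x H nu] at [z] in the direction [h]. *)
Definition rho_gradient x z h : R :=
  D2 f x (z - x) h + `|z - x| `^ (1 + nu) * ip (z - x) h.

Definition Omega_gradient x (H : R) z h : R :=
  'd f x h + D2 f x (z - x) h + 1 / 2 * D3 f x (z - x) (z - x) h
    + (3 + nu) * H / 6 * (`|z - x| `^ (1 + nu) * ip (z - x) h).

Lemma is_diff_rho x z : is_diff z (rho f x nu) (rho_gradient x z).
Proof.
have dQ := is_diff_quadratic_form B_sym B_pos E_norm (z - x) (D2_sym f_diff x)
  (@D2_scalar _ _ f x).
have dN := is_diff_norm_powR B_sym B_pos E_norm (z - x) r3.
have dS := is_diff_translate (is_diffD (is_diffZ (1 / 2) dQ) (is_diffZ (1 / (3 + nu)) dN)).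
apply: (is_diff_eq dS); apply/funext => h.
change (1 / 2 * (2 * D2 f x (z - x) h) + 1 / (3 + nu) *
  ((3 + nu) * `|z - x| `^ (3 + nu - 2) * B (z - x) h) =
  D2 f x (z - x) h + `|z - x| `^ (1 + nu) * ip (z - x) h).
by rewrite r3E; field; rewrite gt_eqF// (lt_trans _ r3).
Qed.

Lemma is_diff_Omega x z (H : R) : is_diff z (Omega f x H nu) (Omega_gradient x H z).
Proof.
have dQ := is_diff_quadratic_form B_sym B_pos E_norm (z - x) (D2_sym f_diff x)
  (@D2_scalar _ _ f x).
have dT := is_diff_cubic_form B_sym B_pos E_norm (z - x)
  (D3_symmetric_trilinear f_diff x).
have dN := is_diff_norm_powR B_sym B_pos E_norm (z - x) r3.
have [d1 _ _] := f_diff.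
have dl : is_diff (z - x) ('d f x) ('d f x).
  have c := diff_continuous (d1 x).
  by split; [exact: linear_differentiable|exact: diff_lin].
have dS := is_diff_translate (is_diffD (is_diffD (is_diffD (is_diffD
  (is_diff_cst (f x : R) (z - x)) dl)
  (is_diffZ (1 / 2) dQ)) (is_diffZ (1 / 6) dT)) (is_diffZ (H / 6) dN)).
apply: (is_diff_eq dS); apply/funext => h.
change (0 + 'd f x h + 1 / 2 * (2 * D2 f x (z - x) h)
  + 1 / 6 * (3 * D3 f x (z - x) (z - x) h) + H / 6 *
  ((3 + nu) * `|z - x| `^ (3 + nu - 2) * B (z - x) h) =
  'd f x h + D2 f x (z - x) h + 1 / 2 * D3 f x (z - x) (z - x) h
    + (3 + nu) * H / 6 * (`|z - x| `^ (1 + nu) * ip (z - x) h)).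
rewrite r3E; move: ('d f x h : R) (D2 _ _ _ _) (D3 _ _ _ _ _) (_ `^ _) (ip _ _).
by move=> *; field.
Qed.

(** The gradient increment of [|.| ^ (3 + nu) / (3 + nu)] between [u - x] and
    [v - x], paired with [v - u]. *)
Definition norm_gap x u v : R := `|v - x| `^ (1 + nu) * ip (v - x) (v - u)
  - `|u - x| `^ (1 + nu) * ip (u - x) (v - u).

Lemma D2_increment x u v :
  D2 f x (v - x) (v - u) - D2 f x (u - x) (v - u) = D2 f x (v - u) (v - u).
Proof.
rewrite !(D2_sym f_diff x _ (v - u)).
have -> : v - x = 1 *: (v - u) + (u - x) by rewrite scale1r addrA subrK.
by rewrite (@D2_scalar _ _ f x) mul1r addrK.
Qed.

Lemma rho_gradient_increment x u v :
  rho_gradient x v (v - u) - rho_gradient x u (v - u)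
    = D2 f x (v - u) (v - u) + norm_gap x u v.
Proof.
rewrite /rho_gradient -(D2_increment x u v) /norm_gap.
by move: (D2 _ _ _ _) (D2 _ _ _ _) (_ * _) (_ * _) => *; ring.
Qed.

Lemma Omega_gradient_increment x u v (H : R) :
  Omega_gradient x H v (v - u) - Omega_gradient x H u (v - u)
    = D2 f x (v - u) (v - u)
      + D3 f x (2^-1 *: ((u - x) + (v - x))) (v - u) (v - u)
      + (3 + nu) * H / 6 * norm_gap x u v.
Proof.
have Tst := D3_symmetric_trilinear f_diff x.
rewrite /Omega_gradient -(D2_increment x u v) /norm_gap.
have vx : v - x = (u - x) + (v - u) by rewrite [RHS]addrC addrA subrK.
rewrite vx; move: (v - u) (u - x) => w a.
move: (trilinear_increment a w Tst).
move: ('d f x w : R) (D2 _ _ _ _) (D2 _ _ _ _) (D3 _ _ _ _ _) (D3 _ _ _ _ _).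
move: (D3 _ _ _ _ _) (_ * ip _ _) (_ * ip _ _) => T1 N1 N2 d q1 q2 T2 T3 T4.
rewrite (_ : T1 = (T3 - T2) / 2); last by lra.
by field.
Qed.

Lemma D3_gradient_bound x u v (t : R) : 0 < t ->
  `|D3 f x (2^-1 *: ((u - x) + (v - x))) (v - u) (v - u)|
    <= D2 f x (v - u) (v - u) / t + t `^ nu * Hf * norm_gap x u v.
Proof.
move=> t0; have /andP[nu0 _] := nu01.
apply: le_trans (D3_convex_bound f_diff B_sym B_pos E_norm nu0 Hf_gt0 f_hoelder
  x _ (v - u) f_convex t0) _.
rewrite lerD2l ler_wpM2l ?mulr_ge0 ?powR_ge0 ?(ltW Hf_gt0)//.
have vu : v - u = (v - x) - (u - x) by rewrite opprB addrA subrK.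
have nu1 : 1 <= 1 + nu by rewrite lerDl.
by have := norm_powR_gradient_monotone (u - x) (v - x) nu1; rewrite -vu.
Qed.

Lemma norm_gap_ge0 x u v : 0 <= norm_gap x u v.
Proof.
have /andP[nu0 _] := nu01; have nu1 : 1 <= 1 + nu by rewrite lerDl.
have vu : v - u = (v - x) - (u - x) by rewrite opprB addrA subrK.
have := norm_powR_gradient_monotone (u - x) (v - x) nu1; rewrite -vu.
by apply: le_trans; rewrite mulr_ge0 ?powR_ge0 ?exprn_ge0.
Qed.

Lemma convex_rho x : convex (rho f x nu).
Proof.
apply: (convex_of_monotone_gradient (is_diff_rho x)) => u v.
rewrite -subr_ge0 rho_gradient_increment addr_ge0 ?norm_gap_ge0//.
exact: D2_convex_ge0.
Qed.

End RelativeSmoothness.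

Theorem theorem3p3 (R : realType) (E : finNormedModType R)
  (B : 'Hom(E, 'Hom(E, R^o))) (f : E -> R) (nu Hf : R) (x : E) (H : R)
  (B_sym : self_adjoint B) (B_pos : positive_definite B)
  (E_norm : normed_by B)
  (f_convex : convex f) (f_diff : thrice_differentiable f)
  (nu01 : 0 <= nu <= 1) (Hf_gt0 : 0 < Hf) (f_hoelder : D3_hoelder f nu Hf)
  (H_gt0 : 0 < H) :
  let t := tauH H nu Hf in
  relatively_smooth (Omega f x H nu) (rho f x nu)
    (Num.max ((t + 1) / t) (t `^ nu * (t + 1) * Hf))
  /\
  (1 <= t ->
   relatively_strongly_convex (Omega f x H nu) (rho f x nu)
     (Num.min ((t - 1) / t) (t `^ nu * (t - 1) * Hf))).
Proof.
move=> t; have /andP[nu0 _] := nu01.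
have c0 : 0 < (3 + nu) * H / (6 * Hf) by rewrite divr_gt0 ?mulr_gt0// ltr_wpDr.
have t0 : 0 < t by exact: powR_gt0.
(* The choice of [tauH]: [t ^ (1 + nu) = (3 + nu) * H / (6 * Hf)]. *)
have HE : (3 + nu) * H / 6 = t * t `^ nu * Hf.
  rewrite -powR1D ?(ltW t0)// /t /tauH -powRrM mul1r mulVf ?gt_eqF ?ltr_wpDr//.
  by rewrite powRr1 ?(ltW c0)//; field; rewrite gt_eqF.
have dO z := is_diff_Omega B_sym B_pos E_norm f_diff nu01 x z H.
have dr := is_diff_rho B_sym B_pos E_norm f_diff nu01 x.
have cr := convex_rho B_sym B_pos E_norm f_convex f_diff nu01 x.
have incr u v := Omega_gradient_increment (B := B) (nu := nu) f_diff x u v H.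
have incr' := rho_gradient_increment (B := B) (nu := nu) f_diff x.
have N0 := norm_gap_ge0 B_sym B_pos E_norm nu01 x.
have D0 u v := D2_convex_ge0 f_diff x (v - u) f_convex.
have bound u v := D3_gradient_bound B_sym B_pos E_norm f_convex f_diff nu01
  Hf_gt0 f_hoelder x u v t0.
have s0 : 0 <= t `^ nu * Hf by rewrite mulr_ge0 ?powR_ge0// ltW.
split=> [|t1].
- apply: (relatively_smooth_of_gradient dO dr cr) => u v.
  rewrite incr incr' HE; set L := Num.max _ _.
  have L1 : 1 + t^-1 <= L.
    by rewrite le_max; apply/orP; left; rewrite mulrDl mul1r divff// gt_eqF.
  have L2 : t * t `^ nu * Hf + t `^ nu * Hf <= L.
    by rewrite le_max; apply/orP; right; rewrite le_eqVlt; apply/orP; left; apply/eqP; ring.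
  have := ler_wpM2r (D0 u v) L1; have := ler_wpM2r (N0 u v) L2.
  have := bound u v; rewrite ler_norml => /andP[_].
  by move: (D2 _ _ _ _) (D3 _ _ _ _ _) (norm_gap _ _ _) => Q T N *; lra.
- apply: (relatively_strongly_convex_of_gradient dO dr cr) => [|u v].
    rewrite le_min divr_ge0 ?subr_ge0 ?(ltW t0)//= mulrAC.
    by rewrite mulr_ge0 ?subr_ge0.
  rewrite incr incr' HE; set M := Num.min _ _.
  have M1 : M <= 1 - t^-1.
    by rewrite ge_min; apply/orP; left; rewrite mulrBl mul1r divff// gt_eqF.
  have M2 : M <= t * t `^ nu * Hf - t `^ nu * Hf.
    by rewrite ge_min; apply/orP; right; rewrite le_eqVlt; apply/orP; left; apply/eqP; ring.
  have := ler_wpM2r (D0 u v) M1; have := ler_wpM2r (N0 u v) M2.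
  have := bound u v; rewrite ler_norml => /andP[+ _].
  by move: (D2 _ _ _ _) (D3 _ _ _ _ _) (norm_gap _ _ _) => Q T N *; lra.
Qed.
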